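(* For all integers $m,n\ge 0$ and every complex $d$ with $\mathrm{Re}(d)>0$, \[ {}_3F_2\!\left(\begin{matrix}1+2m,\ 1+2n,\ d+1\\ m+n+\tfrac52,\ d\end{matrix};\tfrac12\right) =\frac{2\pi\,(\tfrac32)_{m+n+1}}{(2m-2n+1)(2m-2n-1)} \left[\frac{(m+n+\tfrac12)-\frac{1}{d}(2m+1)(2n+1)}{m!\,n!}+\frac{\frac{1}{d}(2m+2n+3)-2}{\pi\,(\tfrac12)_m(\tfrac12)_n}\right]. \]
   Context: For $\lambda\in\mathbb{C}$ and integer $n\ge0$, $(\lambda)_n$ is the Pochhammer symbol: $(\lambda)_0=1$, $(\lambda)_n=\lambda(\lambda+1)\cdots(\lambda+n-1)$ for $n\ge1$. The generalized hypergeometric series is ${}_pF_q\!\left(\begin{matrix}\alpha_1,\dots,\alpha_p\\ \beta_1,\dots,\beta_q\end{matrix};z\right)=\sum_{k=0}^\infty \frac{(\alpha_1)_k\cdots(\alpha_p)_k}{(\beta_1)_k\cdots(\beta_q)_k}\frac{z^k}{k!}$, convergent for $|z|<1$ when $p=q+1$. *)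

(* Defs.v *)
(* Stdlib reals, with Coquelicot for complex numbers and series. *)
From Stdlib Require Import Reals List Factorial.
From Coquelicot Require Import Coquelicot.
Import ListNotations.
Open Scope C_scope.

Fixpoint pochhammer (a : C) (n : nat) : C :=
  match n with
  | O => 1
  | S n' => pochhammer a n' * (a + INR n')
  end.

Definition pochhammer_prod (l : list C) (n : nat) : C :=
  fold_right Cmult 1 (map (fun a => pochhammer a n) l).

(* Coquelicot sets [/ 0 = 0], so this is the usual term only when no lower
   parameter is an integer [<= 0]. *)
Definition hypergeometric_term (al be : list C) (z : C) (k : nat) : C :=
  pochhammer_prod al k / pochhammer_prod be k * (z ^ k / INR (fact k)).

(* The series pFq(al; be; z), with p = length al and q = length be, converges
   in C to s. *)
Definition is_hypergeometric (al be : list C) (z s : C) : Prop :=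
  is_series (V := C_NormedModule) (hypergeometric_term al be z) s.

(* Main.v *)
(* Since (d+1)_k/(d)_k = 1 + k/d, the series is S0 + S1/d, where S0 and S1 are the
   sums of t_k and of k t_k, with t_k the terms of 2F1(a, b; (a+b+3)/2; 1/2) at
   a = 1+2m, b = 1+2n.  Creative telescoping expresses the pair (S0, S1) at (a+2, b)
   linearly through the pair at (a, b), and everything is symmetric in a and b, so
   induction reduces to m = n = 0.  There, expanding 1/(1+x^2) in powers of
   (1-x^2)/2 and integrating x^2/(1+x^2) over [0,1] gives S0 = 6(1 - PI/4), and the
   first-order recurrence of t_k gives S1 = 3 - 2 S0. *)
Require Import Defs.
From Stdlib Require Import Reals List Factorial Lra Lia.
From Coquelicot Require Import Coquelicot.
Import ListNotations.
Open Scope R_scope.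

(** * Real Pochhammer symbols and the terms of the Gauss series at 1/2 *)

Fixpoint rising (a : R) (n : nat) : R :=
  match n with
  | O => 1
  | S n' => rising a n' * (a + INR n')
  end.

(** The [k]-th term of 2F1(a, b; c; 1/2). *)
Definition half_term (a b c : R) (k : nat) : R :=
  rising a k * rising b k / (rising c k * INR (fact k)) * (1 / 2) ^ k.

Lemma rising_pos (a : R) (n : nat) : 0 < a -> 0 < rising a n.
Proof.
  intros Ha; induction n as [|n IH]; simpl; [lra|].
  apply Rmult_lt_0_compat; [exact IH|].
  pose proof (pos_INR n); lra.
Qed.

Lemma rising_shift (a : R) (n : nat) :
  a * rising (a + 1) n = rising a n * (a + INR n).
Proof.
  induction n as [|n IH]; [simpl; ring|].
  change (a * (rising (a + 1) n * (a + 1 + INR n)) =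
          rising a n * (a + INR n) * (a + INR (S n))).
  rewrite <- Rmult_assoc, IH, S_INR; ring.
Qed.

Lemma half_term_pos (a b c : R) (k : nat) :
  0 < a -> 0 < b -> 0 < c -> 0 < half_term a b c k.
Proof.
  intros Ha Hb Hc; unfold half_term, Rdiv.
  pose proof (rising_pos a k Ha); pose proof (rising_pos b k Hb).
  pose proof (rising_pos c k Hc); pose proof (INR_fact_lt_0 k).
  apply Rmult_lt_0_compat; [apply Rmult_lt_0_compat|apply pow_lt; lra].
  - now apply Rmult_lt_0_compat.
  - now apply Rinv_0_lt_compat, Rmult_lt_0_compat.
Qed.

Lemma half_term_comm (a b c : R) (k : nat) :
  half_term a b c k = half_term b a c k.
Proof. unfold half_term; now rewrite (Rmult_comm (rising a k)). Qed.

Lemma half_term_S (a b c : R) (k : nat) : 0 < c ->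
  half_term a b c (S k) =
  half_term a b c k *
    ((a + INR k) * (b + INR k) / (2 * (c + INR k) * (INR k + 1))).
Proof.
  intros Hc; unfold half_term.
  pose proof (rising_pos c k Hc); pose proof (INR_fact_lt_0 k).
  pose proof (pos_INR k).
  rewrite fact_simpl, mult_INR, S_INR; simpl; field; lra.
Qed.

(** Together with [half_term_S], this makes every term in the creative telescoping a rational
    multiple of [half_term a b c k], so that the identities there reduce to rational ones in
    [INR k]. *)
Lemma half_term_shift (a b c : R) (k : nat) : 0 < a -> 0 < c ->
  half_term (a + 2) b (c + 1) k =
  half_term a b c k *
    (c * (a + INR k) * (a + 1 + INR k) / (a * (a + 1) * (c + INR k))).
Proof.
  intros Ha Hc; unfold half_term.
  pose proof (rising_pos c k Hc); pose proof (INR_fact_lt_0 k).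
  pose proof (pos_INR k).
  assert (Hnum : rising (a + 2) k =
    rising a k * (a + INR k) * (a + 1 + INR k) / (a * (a + 1))).
  { pose proof (rising_shift a k) as Hs1.
    pose proof (rising_shift (a + 1) k) as Hs2.
    replace (a + 1 + 1) with (a + 2) in Hs2 by ring.
    apply (Rmult_eq_reg_l (a * (a + 1))); [|nra].
    transitivity (a * ((a + 1) * rising (a + 2) k)); [ring|].
    rewrite Hs2, <- Rmult_assoc, Hs1; field; lra. }
  assert (Hden : rising (c + 1) k = rising c k * (c + INR k) / c).
  { rewrite <- rising_shift; field; lra. }
  rewrite Hnum, Hden; field; lra.
Qed.

(** * Convergence with polynomial weights *)

Lemma is_lim_seq_shift_ratio (a b : R) : 0 < b ->
  is_lim_seq (fun k => (a + INR k) / (b + INR k)) 1.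
Proof.
  intros Hb.
  apply is_lim_seq_ext with (fun k => 1 + (a - b) * / (b + INR k)).
  { intros k; pose proof (pos_INR k); field; lra. }
  replace (Finite 1) with (Finite (1 + (a - b) * 0)) by (f_equal; ring).
  apply is_lim_seq_plus'; [apply is_lim_seq_const|].
  apply is_lim_seq_mult'; [apply is_lim_seq_const|].
  apply is_lim_seq_inv with (l := p_infty); [|discriminate].
  apply is_lim_seq_le_p_loc with INR; [|apply is_lim_seq_INR].
  exists 0%nat; intros; lra.
Qed.

(** Ratio test: consecutive terms have a quotient tending to 1/2. The weight has degree two in order
    to dominate the telescoping certificates, and [1 + INR k] keeps it nonzero at [k = 0], as the
    test demands. *)
Lemma half_term_sqr_ex_series (a b c : R) : 0 < a -> 0 < b -> 0 < c ->
  ex_series (fun k => (1 + INR k) ^ 2 * half_term a b c k).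
Proof.
  intros Ha Hb Hc.
  assert (Hpos : forall k, 0 < (1 + INR k) ^ 2 * half_term a b c k).
  { intros k; pose proof (pos_INR k).
    apply Rmult_lt_0_compat; [apply pow_lt; lra|now apply half_term_pos]. }
  apply ex_series_ext with
    (fun k => Rabs ((1 + INR k) ^ 2 * half_term a b c k)).
  { intros k; apply Rabs_pos_eq, Rlt_le, Hpos. }
  apply ex_series_DAlembert with (1 / 2); [lra|intros k; apply Rgt_not_eq, Hpos|].
  apply is_lim_seq_ext with
    (fun k => 1 / 2 * ((2 + INR k) / (1 + INR k) * ((2 + INR k) / (1 + INR k))
       * ((a + INR k) / (c + INR k) * ((b + INR k) / (1 + INR k))))).
  { intros k; rewrite Rabs_pos_eq.
    - pose proof (half_term_pos a b c k Ha Hb Hc); pose proof (pos_INR k).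
      rewrite half_term_S, S_INR by exact Hc; field; lra.
    - apply Rlt_le, Rdiv_lt_0_compat; apply Hpos. }
  replace (Finite (1 / 2)) with (Finite (1 / 2 * (1 * 1 * (1 * 1))))
    by (f_equal; ring).
  apply is_lim_seq_mult'; [apply is_lim_seq_const|].
  apply is_lim_seq_mult'; apply is_lim_seq_mult';
    apply is_lim_seq_shift_ratio; lra.
Qed.

(** The weight is at most [(Rabs p + Rabs q) * (1 + INR k) ^ 2] in absolute value, and the terms of
    a convergent series tend to 0. This removes the boundary term at infinity when telescoping. *)
Lemma half_term_sqr_lim (a b c : R) (p q : R) : 0 < a -> 0 < b -> 0 < c ->
  is_lim_seq (fun k => INR k * (p + q * INR k) * half_term a b c k) 0.
Proof.
  intros Ha Hb Hc.
  pose proof (ex_series_lim_0 _ (half_term_sqr_ex_series a b c Ha Hb Hc)) as H.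
  apply is_lim_seq_abs_0.
  apply is_lim_seq_le_le with (fun _ => 0)
    (fun k => (Rabs p + Rabs q) * ((1 + INR k) ^ 2 * half_term a b c k)).
  - intros k; split; [apply Rabs_pos|].
    pose proof (half_term_pos a b c k Ha Hb Hc) as Ht.
    pose proof (pos_INR k) as Hk.
    rewrite Rabs_mult, (Rabs_pos_eq (half_term a b c k)), <- Rmult_assoc by lra.
    apply Rmult_le_compat_r; [lra|].
    rewrite Rabs_mult, (Rabs_pos_eq (INR k)) by lra.
    pose proof (Rabs_triang p (q * INR k)) as Htri.
    rewrite Rabs_mult, (Rabs_pos_eq (INR k)) in Htri by lra.
    pose proof (Rabs_pos p); pose proof (Rabs_pos q); nra.
  - apply is_lim_seq_const.
  - replace (Finite 0) with (Finite ((Rabs p + Rabs q) * 0))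
      by (f_equal; ring).
    apply is_lim_seq_mult'; [apply is_lim_seq_const|exact H].
Qed.

(** * Telescoping and the recurrence in the first parameter *)

Lemma is_series_telescope (g : nat -> R) (l : R) : is_lim_seq g l ->
  is_series (fun k => g (S k) - g k) (l - g 0%nat).
Proof.
  intros Hg.
  change (is_lim_seq (sum_n (fun k => g (S k) - g k)) (l - g 0%nat)).
  apply is_lim_seq_ext with (fun n => g (S n) - g 0%nat).
  { intros n; induction n as [|n IH].
    - now rewrite sum_O.
    - rewrite sum_Sn, <- IH; unfold plus; simpl; ring. }
  apply is_lim_seq_minus'; [now apply is_lim_seq_incr_1 in Hg|].
  apply is_lim_seq_const.
Qed.

Lemma is_series_eq (u v : nat -> R) (k l : R) :
  (forall n, u n = v n) -> k = l -> is_series u k -> is_series v l.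
Proof. intros Huv <-; now apply is_series_ext. Qed.

(** The relation [c = (a + b + 3) / 2] survives the passage from (a, b, c) to (a + 2, b, c + 1), so
    the step can be iterated. *)
Lemma half_term_step (a b c S0 S1 : R) :
  0 < a -> 0 < b -> c = (a + b + 3) / 2 -> a - b + 3 <> 0 ->
  is_series (half_term a b c) S0 ->
  is_series (fun k => INR k * half_term a b c k) S1 ->
  is_series (half_term (a + 2) b (c + 1))
    ((1 + b * (a - b - 1) / ((a + 1) * (a - b + 3))) * S0
     + 4 * c / (a * (a + 1) * (a - b + 3)) * S1) /\
  is_series (fun k => INR k * half_term (a + 2) b (c + 1) k)
    (4 * c * b / ((a + 1) * (a - b + 3)) * S0
     + c / (a * (a + 1)) * (2 * a - 4 * c / (a - b + 3)) * S1).
Proof.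
  intros Ha Hb Hc He H0 H1.
  assert (Hc0 : 0 < c) by lra.
  set (L := c / (a * (a + 1))).
  set (q := - 2 * L * (a - b - 1) / (a - b + 3)).
  (* The certificates [INR k * (p + r * INR k)] are found by matching powers of
     [INR k] in the two term identities below. *)
  assert (Hcomb : forall x y p r,
    is_series (fun k => (x + y * INR k) * half_term a b c k
      + (INR (S k) * (p + r * INR (S k)) * half_term a b c (S k)
         - INR k * (p + r * INR k) * half_term a b c k))
      (x * S0 + y * S1)).
  { intros x y p r.
    (* The telescoped part adds nothing to the sum: the certificate tends to 0, and its factor
       [INR k] makes it vanish at [k = 0]. *)
    pose proof (is_series_telescope _ _ (half_term_sqr_lim a b c p r Ha Hb Hc0))
      as Hg.
    pose proof (is_series_plus _ _ _ _ (is_series_plus _ _ _ _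
      (is_series_scal x _ _ H0) (is_series_scal y _ _ H1)) Hg) as H.
    revert H; apply is_series_eq.
    - intros k; unfold plus, scal; simpl; unfold mult; simpl; ring.
    - unfold plus, scal; simpl; unfold mult; simpl; ring. }
  split.
  - generalize (Hcomb (1 + b * (a - b - 1) / ((a + 1) * (a - b + 3)))
      (4 * c / (a * (a + 1) * (a - b + 3))) q 0).
    apply is_series_eq; [|reflexivity].
    intros k; pose proof (pos_INR k).
    rewrite half_term_shift, half_term_S, S_INR by lra.
    unfold q, L; subst c; field; repeat split; lra.
  (* The extra weight [INR k] raises the degree of the identity by one, hence the certificate with a
     quadratic term. *)
  - generalize (Hcomb (4 * c * b / ((a + 1) * (a - b + 3)))
      (c / (a * (a + 1)) * (2 * a - 4 * c / (a - b + 3)))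
      (- c * q + 2 * L * (1 - c)) (- 2 * L)).
    apply is_series_eq; [|reflexivity].
    intros k; pose proof (pos_INR k).
    rewrite half_term_shift, half_term_S, S_INR by lra.
    unfold q, L; subst c; field; repeat split; lra.
Qed.

(** * The base case: the series at a = b = 1, c = 5/2 *)

(** A Beta integral. The integrals and the terms share the ratio (k + 1) / (2k + 5), and 1/3 is the
    integral at [k = 0]. *)
Lemma is_RInt_sqr_half_term (k : nat) :
  is_RInt (fun x => x ^ 2 * ((1 - x ^ 2) / 2) ^ k) 0 1
    (half_term 1 1 (5 / 2) k / 3).
Proof.
  induction k as [|k IH].
  - replace (half_term 1 1 (5 / 2) 0 / 3) with (minus (1 ^ 3 / 3) (0 ^ 3 / 3))
      by (unfold half_term, minus, plus, opp; simpl; field).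
    apply (is_RInt_derive (fun x => x ^ 3 / 3)).
    + intros x _; auto_derive; [exact I|simpl; field].
    + intros x _; apply (ex_derive_continuous (V := R_NormedModule)).
      auto_derive; exact I.
  - pose proof (pos_INR k) as Hk.
    (* Integrating the derivative of x^3 ((1 - x^2)/2)^(k+1), which vanishes at
       both ends, yields (2k + 5) J_(k+1) = (k + 1) J_k for the integrals J_k. *)
    assert (Hd : is_RInt (fun x => (2 * INR k + 5) * (x ^ 2 * ((1 - x ^ 2) / 2) ^ S k)
        - (INR k + 1) * (x ^ 2 * ((1 - x ^ 2) / 2) ^ k)) 0 1
      (minus (1 ^ 3 * ((1 - 1 ^ 2) / 2) ^ S k)
             (0 ^ 3 * ((1 - 0 ^ 2) / 2) ^ S k))).
    { apply (is_RInt_derive (fun x => x ^ 3 * ((1 - x ^ 2) / 2) ^ S k)).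
      - intros x _; auto_derive; [exact I|].
        change (match k with O => 1 | S _ => INR k + 1 end) with (INR (S k)).
        rewrite S_INR; simpl; unfold Rminus, Rdiv; field.
      - intros x _; apply (ex_derive_continuous (V := R_NormedModule)).
        auto_derive; exact I. }
    pose proof (is_RInt_scal _ _ _ (/ (2 * INR k + 5)) _
      (is_RInt_plus _ _ _ _ _ _ Hd (is_RInt_scal _ _ _ (INR k + 1) _ IH))) as H.
    replace (half_term 1 1 (5 / 2) (S k) / 3) with
      (scal (/ (2 * INR k + 5)) (plus (minus (1 ^ 3 * ((1 - 1 ^ 2) / 2) ^ S k)
             (0 ^ 3 * ((1 - 0 ^ 2) / 2) ^ S k))
         (scal (INR k + 1) (half_term 1 1 (5 / 2) k / 3)))).
    + revert H; apply is_RInt_ext; intros x _.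
      unfold plus, scal; simpl; unfold mult; simpl; field; lra.
    + rewrite half_term_S by lra.
      unfold minus, plus, opp, scal; simpl; unfold mult; simpl; field; lra.
Qed.

(** With w = (1 - x^2)/2 one has 1 + x^2 = 2(1 - w), so the integrand is the remainder of the
    geometric expansion of x^2/(1 + x^2) after the power w^n. *)
Lemma is_RInt_sqr_half_term_remainder (n : nat) :
  is_RInt (fun x => x ^ 2 * ((1 - x ^ 2) / 2) ^ S n / (1 + x ^ 2)) 0 1
    (1 - PI / 4 - sum_n (half_term 1 1 (5 / 2)) n / 6).
Proof.
  (* Since w = 1 - (1 + x^2)/2, replacing w^k by w^(k+1) subtracts x^2 w^k / 2 from the integrand;
     its integral is half of [half_term 1 1 (5 / 2) k / 3]. *)
  assert (Hstep : forall k l,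
    is_RInt (fun x => x ^ 2 * ((1 - x ^ 2) / 2) ^ k / (1 + x ^ 2)) 0 1 l ->
    is_RInt (fun x => x ^ 2 * ((1 - x ^ 2) / 2) ^ S k / (1 + x ^ 2)) 0 1
      (l - half_term 1 1 (5 / 2) k / 6)).
  { intros k l Hl.
    pose proof (is_RInt_minus _ _ _ _ _ _ Hl
      (is_RInt_scal _ _ _ (1 / 2) _ (is_RInt_sqr_half_term k))) as H.
    replace (l - half_term 1 1 (5 / 2) k / 6) with
      (minus l (scal (1 / 2) (half_term 1 1 (5 / 2) k / 3)))
      by (unfold minus, plus, opp, scal; simpl; unfold mult; simpl; field).
    revert H; apply is_RInt_ext; intros x _.
    unfold minus, plus, opp, scal; simpl; unfold mult; simpl; field; nra. }
  assert (Hbase :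
    is_RInt (fun x => x ^ 2 * ((1 - x ^ 2) / 2) ^ 0 / (1 + x ^ 2)) 0 1
      (1 - PI / 4)).
  { replace (1 - PI / 4) with (minus (1 - atan 1) (0 - atan 0))
      by (rewrite atan_1, atan_0; unfold minus, plus, opp; simpl; ring).
    apply (is_RInt_derive (fun x => x - atan x)).
    - intros x _; auto_derive; [exact I|simpl; unfold Rsqr; field; nra].
    - intros x _; apply (ex_derive_continuous (V := R_NormedModule)).
      auto_derive; simpl; nra. }
  induction n as [|n IH].
  - rewrite sum_O; now apply Hstep.
  - rewrite sum_Sn; unfold plus; simpl.
    replace (1 - PI / 4 - (sum_n (half_term 1 1 (5 / 2)) n
               + half_term 1 1 (5 / 2) (S n)) / 6)
      with (1 - PI / 4 - sum_n (half_term 1 1 (5 / 2)) n / 6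
            - half_term 1 1 (5 / 2) (S n) / 6) by field.
    exact (Hstep _ _ IH).
Qed.

Lemma is_series_half_term_1_1 :
  is_series (half_term 1 1 (5 / 2)) (6 - 3 * PI / 2).
Proof.
  set (r := fun n => 1 - PI / 4 - sum_n (half_term 1 1 (5 / 2)) n / 6).
  assert (Hr : is_lim_seq r 0).
  (* On (0, 1), w lies between 0 and 1/2 and x^2/(1 + x^2) between 0 and 1, which squeezes the
     remainder integral. *)
  { apply is_lim_seq_le_le with (fun _ => 0) (fun n => (1 / 2) ^ S n).
    - intros n; pose proof (is_RInt_sqr_half_term_remainder n) as Hn.
      assert (Hx : forall x, 0 < x < 1 ->
        0 <= x ^ 2 * ((1 - x ^ 2) / 2) ^ S n / (1 + x ^ 2) <= (1 / 2) ^ S n).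
      { intros x Hx.
        assert (Hw : 0 <= ((1 - x ^ 2) / 2) ^ S n <= (1 / 2) ^ S n).
        { split; [apply pow_le|apply pow_incr]; nra. }
        assert (Hf : 0 <= x ^ 2 / (1 + x ^ 2) <= 1).
        { split; [apply Rle_div_r|apply Rle_div_l]; nra. }
        replace (x ^ 2 * ((1 - x ^ 2) / 2) ^ S n / (1 + x ^ 2)) with
          (x ^ 2 / (1 + x ^ 2) * ((1 - x ^ 2) / 2) ^ S n)
          by (unfold Rdiv; ring).
        split; [apply Rmult_le_pos|]; try lra.
        rewrite <- (Rmult_1_l ((1 / 2) ^ S n)).
        apply Rmult_le_compat; lra. }
      assert (Hcst : forall v : R, is_RInt (fun _ : R => v) 0 1 v).
      { intros v; pose proof (is_RInt_const 0 1 v) as H.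
        unfold scal in H; simpl in H; unfold mult in H; simpl in H.
        now replace ((1 - 0) * v) with v in H by ring. }
      split.
      + apply (is_RInt_le _ _ 0 1 _ _ Rle_0_1 (Hcst 0) Hn).
        intros x Hx'; now apply Hx.
      + apply (is_RInt_le _ _ 0 1 _ _ Rle_0_1 Hn (Hcst ((1 / 2) ^ S n))).
        intros x Hx'; now apply Hx.
    - apply is_lim_seq_const.
    - apply -> (is_lim_seq_incr_1 (fun n => (1 / 2) ^ n)).
      apply is_lim_seq_geom; rewrite Rabs_pos_eq; lra. }
  change (is_lim_seq (sum_n (half_term 1 1 (5 / 2))) (6 - 3 * PI / 2)).
  apply is_lim_seq_ext with (fun n => 6 - 3 * PI / 2 - 6 * r n).
  { intros n; unfold r; field. }
  replace (Finite (6 - 3 * PI / 2)) with (Finite (6 - 3 * PI / 2 - 6 * 0))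
    by (f_equal; ring).
  apply is_lim_seq_minus'; [apply is_lim_seq_const|].
  apply is_lim_seq_mult'; [apply is_lim_seq_const|exact Hr].
Qed.

Lemma is_series_INR_half_term_1_1 :
  is_series (fun k => INR k * half_term 1 1 (5 / 2) k) (3 * PI - 9).
Proof.
  (* As (2k + 5) t_(k+1) = (k + 1) t_k, the forward difference of (2k + 3) t_k is -(k + 2) t_k.
     Summing it gives S1 + 2 S0 = 3, the value at [k = 0]. *)
  assert (Hg : is_lim_seq (fun k => (2 * INR k + 3) * half_term 1 1 (5 / 2) k) 0).
  { pose proof (ex_series_lim_0 _
      (ex_intro _ _ is_series_half_term_1_1)) as H0.
    pose proof (half_term_sqr_lim 1 1 (5 / 2) 2 0 ltac:(lra) ltac:(lra)
      ltac:(lra)) as H1.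
    pose proof (is_lim_seq_mult' _ _ _ _ (is_lim_seq_const 3) H0) as H3.
    pose proof (is_lim_seq_plus' _ _ _ _ H1 H3) as H.
    replace (0 + 3 * 0) with 0 in H by ring.
    revert H; apply is_lim_seq_ext; intros k; ring. }
  pose proof (is_series_plus _ _ _ _ (is_series_telescope _ _ Hg)
    (is_series_scal 2 _ _ is_series_half_term_1_1)) as H.
  pose proof (is_series_scal (-1) _ _ H) as H'.
  revert H'; apply is_series_eq.
  - intros k; pose proof (pos_INR k).
    rewrite half_term_S, S_INR by lra.
    unfold plus, scal; simpl; unfold mult; simpl; field; lra.
  - unfold plus, scal; simpl; unfold mult; simpl.
    unfold half_term; simpl; field.
Qed.

(** * Closed forms and the induction on [m] and [n] *)

Definition prefactor (m n : nat) : R :=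
  2 * PI * rising (3 / 2) (m + n + 1)
    / ((2 * INR m - 2 * INR n + 1) * (2 * INR m - 2 * INR n - 1)).

(** The part of the claimed value free of 1/d; [half_sum_INR] is the coefficient of 1/d. *)
Definition half_sum (m n : nat) : R :=
  prefactor m n *
    ((INR m + INR n + 1 / 2) / (INR (fact m) * INR (fact n))
     - 2 / (PI * rising (1 / 2) m * rising (1 / 2) n)).

Definition half_sum_INR (m n : nat) : R :=
  prefactor m n *
    ((2 * INR m + 2 * INR n + 3) / (PI * rising (1 / 2) m * rising (1 / 2) n)
     - (2 * INR m + 1) * (2 * INR n + 1) / (INR (fact m) * INR (fact n))).

(** Both sums are carried together because the recurrence for either one involves both. *)
Definition half_sums (m n : nat) : Prop :=
  is_series (half_term (1 + 2 * INR m) (1 + 2 * INR n) (INR m + INR n + 5 / 2))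
    (half_sum m n) /\
  is_series (fun k => INR k *
      half_term (1 + 2 * INR m) (1 + 2 * INR n) (INR m + INR n + 5 / 2) k)
    (half_sum_INR m n).

(** An odd integer is nonzero. The values 0, -1 and 1 of [j] cover the denominators of [prefactor]
    and of the recurrence. *)
Lemma odd_diff_neq_0 (m n : nat) (j : Z) :
  2 * INR m - 2 * INR n + IZR (2 * j + 1) <> 0.
Proof.
  rewrite !INR_IZR_INZ, <- !mult_IZR, <- minus_IZR, <- plus_IZR.
  apply not_0_IZR; lia.
Qed.

Lemma half_sums_comm (m n : nat) : half_sums m n -> half_sums n m.
Proof.
  pose proof (odd_diff_neq_0 m n 0) as E1; pose proof (odd_diff_neq_0 m n (-1)) as E2.
  simpl in E1, E2.
  pose proof (rising_pos (1 / 2) m ltac:(lra)).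
  pose proof (rising_pos (1 / 2) n ltac:(lra)).
  pose proof (INR_fact_lt_0 m); pose proof (INR_fact_lt_0 n).
  pose proof PI_RGT_0.
  (* The swap exchanges the two odd factors of the denominator up to sign, and the two signs
     cancel. *)
  assert (Hp : prefactor m n = prefactor n m).
  { unfold prefactor; rewrite (Nat.add_comm m n); field; repeat split; lra. }
  intros [Hs0 Hs1]; split.
  - revert Hs0; apply is_series_eq.
    + intros k; rewrite half_term_comm; now rewrite (Rplus_comm (INR m)).
    + unfold half_sum; rewrite Hp; field; repeat split; lra.
  - revert Hs1; apply is_series_eq.
    + intros k; rewrite half_term_comm; now rewrite (Rplus_comm (INR m)).
    + unfold half_sum_INR; rewrite Hp; field; repeat split; lra.
Qed.

Lemma half_sums_S (m n : nat) : half_sums m n -> half_sums (S m) n.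
Proof.
  pose proof (odd_diff_neq_0 m n 0) as E1; pose proof (odd_diff_neq_0 m n (-1)) as E2.
  pose proof (odd_diff_neq_0 m n 1) as E3; simpl in E1, E2, E3.
  pose proof (rising_pos (1 / 2) m ltac:(lra)).
  pose proof (rising_pos (1 / 2) n ltac:(lra)).
  pose proof (INR_fact_lt_0 m); pose proof (INR_fact_lt_0 n).
  pose proof PI_RGT_0; pose proof (pos_INR m); pose proof (pos_INR n).
  (* The factor 2m - 2n + 1 occurs in both denominators and cancels; m + n + 5/2 is the new factor
     of the Pochhammer symbol. *)
  assert (Hp : prefactor (S m) n =
    prefactor m n * ((INR m + INR n + 5 / 2) * (2 * INR m - 2 * INR n - 1)
                     / (2 * INR m - 2 * INR n + 3))).
  { unfold prefactor.
    change (S m + n + 1)%nat with (S (m + n + 1)); cbn [rising].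
    rewrite S_INR, !plus_INR; simpl (INR 1); field; repeat split; lra. }
  intros [Hs0 Hs1].
  destruct (half_term_step (1 + 2 * INR m) (1 + 2 * INR n)
    (INR m + INR n + 5 / 2) _ _ ltac:(lra) ltac:(lra) ltac:(lra) ltac:(lra) Hs0 Hs1)
    as [Hs0' Hs1'].
  assert (Ht : forall k,
    half_term (1 + 2 * INR m + 2) (1 + 2 * INR n) (INR m + INR n + 5 / 2 + 1) k =
    half_term (1 + 2 * INR (S m)) (1 + 2 * INR n) (INR (S m) + INR n + 5 / 2) k).
  { intros k; rewrite S_INR; f_equal; ring. }
  split.
  - revert Hs0'; apply is_series_eq; [exact Ht|].
    unfold half_sum, half_sum_INR; rewrite Hp, fact_simpl, mult_INR, S_INR.
    cbn [rising]; field; repeat split; lra.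
  - revert Hs1'; apply is_series_eq; [intros k; now rewrite Ht|].
    unfold half_sum, half_sum_INR; rewrite Hp, fact_simpl, mult_INR, S_INR.
    cbn [rising]; field; repeat split; lra.
Qed.

Lemma half_sums_all (m n : nat) : half_sums m n.
Proof.
  assert (H00 : half_sums 0 0).
  { pose proof PI_RGT_0; split.
    - generalize is_series_half_term_1_1; apply is_series_eq.
      + intros k; simpl; f_equal; ring.
      + unfold half_sum, prefactor; simpl; field; lra.
    - generalize is_series_INR_half_term_1_1; apply is_series_eq.
      + intros k; simpl; f_equal; f_equal; ring.
      + unfold half_sum_INR, prefactor; simpl; field; lra. }
  induction m as [|m IH]; [|now apply half_sums_S].
  (* At [m = 0], symmetry moves [n] into the first position, the one that [half_sums_S] raises. *)
  apply half_sums_comm; induction n as [|n IH]; [exact H00|now apply half_sums_S].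
Qed.

(** * Transfer to complex series and conclusion *)

Lemma is_series_RtoC (u : nat -> R) (l : R) : is_series u l ->
  is_series (V := C_NormedModule) (fun k => RtoC (u k)) (RtoC l).
Proof.
  intros Hu.
  assert (Hsum : forall n,
    RtoC (sum_n u n) = sum_n (G := C_AbelianMonoid) (fun k => RtoC (u k)) n).
  { induction n as [|n IH]; [now rewrite !sum_O|].
    rewrite !sum_Sn, <- IH; apply RtoC_plus. }
  apply filterlim_ext with (1 := Hsum).
  apply filterlim_comp with (1 := Hu), filterlim_locally.
  (* Balls in C are products of balls, and the imaginary parts agree, so the same radius serves. *)
  intros eps; exists eps; intros x Hx; split; [exact Hx|apply ball_center].
Qed.

Lemma pochhammer_RtoC (a : R) (n : nat) :
  pochhammer (RtoC a) n = RtoC (rising a n).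
Proof.
  induction n as [|n IH]; simpl; [reflexivity|].
  now rewrite IH, RtoC_mult, RtoC_plus.
Qed.

Open Scope C_scope.

Lemma pochhammer_shift (a : C) (n : nat) :
  a * pochhammer (a + 1) n = pochhammer a n * (a + INR n).
Proof.
  induction n as [|n IH]; [simpl; ring|].
  change (a * (pochhammer (a + 1) n * (a + 1 + INR n)) =
          pochhammer a n * (a + INR n) * (a + INR (S n))).
  rewrite Cmult_assoc, IH, S_INR, RtoC_plus; ring.
Qed.

Lemma RtoC_neq_0 (x : R) : x <> 0%R -> RtoC x <> 0.
Proof. intros Hx H; apply Hx; now apply RtoC_inj. Qed.

Lemma pochhammer_neq_0 (d : C) (n : nat) : (0 < Re d)%R -> pochhammer d n <> 0.
Proof.
  intros Hd; induction n as [|n IH]; simpl; [apply RtoC_neq_0; lra|].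
  apply Cmult_neq_0; [exact IH|].
  (* Each factor [d + INR n] has positive real part. *)
  intros H; apply (f_equal Re) in H; simpl in H.
  pose proof (pos_INR n); unfold Re in *; lra.
Qed.

Lemma hypergeometric_term_half (a b c : R) (d : C) (k : nat) :
  (0 < c)%R -> (0 < Re d)%R ->
  hypergeometric_term [RtoC a; RtoC b; d + 1] [RtoC c; d] (1 / 2) k =
  half_term a b c k + / d * RtoC (INR k * half_term a b c k).
Proof.
  intros Hc Hd.
  pose proof (RtoC_neq_0 _ (Rgt_not_eq _ _ (rising_pos c k Hc))) as Hck.
  pose proof (RtoC_neq_0 _ (Rgt_not_eq _ _ (INR_fact_lt_0 k))) as Hk.
  pose proof (pochhammer_neq_0 d k Hd) as Hdk.
  assert (Hd0 : d <> 0) by (intros ->; simpl in Hd; lra).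
  assert (Hshift : pochhammer (d + 1) k = pochhammer d k * (d + INR k) / d).
  { rewrite <- pochhammer_shift; field; exact Hd0. }
  assert (Hterm : RtoC (half_term a b c k) =
    rising a k * rising b k / (rising c k * INR (fact k)) * (1 / 2) ^ k).
  { pose proof (rising_pos c k Hc); pose proof (INR_fact_lt_0 k).
    unfold half_term.
    rewrite RtoC_mult, RtoC_pow, !RtoC_div, !RtoC_mult; [reflexivity|lra|nra]. }
  unfold hypergeometric_term, pochhammer_prod; simpl.
  rewrite !pochhammer_RtoC, Hshift, RtoC_mult, Hterm.
  field; repeat split; assumption.
Qed.

Theorem theorem3 (m n : nat) (d : C) (Hd : (0 < Re d)%R) :
  is_hypergeometric
    [1 + 2 * INR m; 1 + 2 * INR n; d + 1]
    [INR m + INR n + 5 / 2; d]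
    (1 / 2)
    (2 * PI * pochhammer (3 / 2) (m + n + 1)
       / ((2 * INR m - 2 * INR n + 1) * (2 * INR m - 2 * INR n - 1))
     * ((INR m + INR n + 1 / 2 - 1 / d * (2 * INR m + 1) * (2 * INR n + 1))
          / (INR (fact m) * INR (fact n))
        + (1 / d * (2 * INR m + 2 * INR n + 3) - 2)
          / (PI * pochhammer (1 / 2) m * pochhammer (1 / 2) n))).
Proof.
  pose proof (pos_INR m); pose proof (pos_INR n).
  destruct (half_sums_all m n) as [Hs0 Hs1].
  pose proof (is_series_plus _ _ _ _ (is_series_RtoC _ _ Hs0)
    (is_series_scal (K := C_AbsRing) (/ d) _ _ (is_series_RtoC _ _ Hs1))) as Hs.
  unfold is_hypergeometric.
  replace (1 + 2 * INR m) with (RtoC (1 + 2 * INR m))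
    by now rewrite RtoC_plus, RtoC_mult.
  replace (1 + 2 * INR n) with (RtoC (1 + 2 * INR n))
    by now rewrite RtoC_plus, RtoC_mult.
  replace (INR m + INR n + 5 / 2) with (RtoC (INR m + INR n + 5 / 2))
    by now rewrite !RtoC_plus, RtoC_div.
  (* What remains besides the termwise identity is to split the claimed value by powers of 1/d. *)
  match goal with |- is_series _ ?s =>
    cut (half_sum m n + / d * half_sum_INR m n = s) end.
  - intros <-; revert Hs; apply is_series_ext; intros k.
    rewrite hypergeometric_term_half by (assumption || lra); reflexivity.
  - pose proof (odd_diff_neq_0 m n 0) as E1.
    pose proof (odd_diff_neq_0 m n (-1)) as E2; simpl in E1, E2.
    pose proof (rising_pos (1 / 2) m ltac:(lra)) as Hrm.
    pose proof (rising_pos (1 / 2) n ltac:(lra)) as Hrn.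
    pose proof (INR_fact_lt_0 m) as Hfm; pose proof (INR_fact_lt_0 n) as Hfn.
    pose proof PI_RGT_0 as Hpi.
    assert (Hd0 : d <> 0) by (intros ->; simpl in Hd; lra).
    rewrite <- !RtoC_div, !pochhammer_RtoC by lra.
    unfold half_sum, half_sum_INR, prefactor.
    assert (E : ((2 * INR m - 2 * INR n + 1) * (2 * INR m - 2 * INR n - 1))%R
      <> 0%R) by (apply Rmult_integral_contrapositive_currified; lra).
    assert (Hr : (PI * rising (1 / 2) m * rising (1 / 2) n)%R <> 0%R).
    { now apply Rgt_not_eq; repeat (assumption || apply Rmult_lt_0_compat). }
    assert (Hf : (INR (fact m) * INR (fact n))%R <> 0%R).
    { now apply Rgt_not_eq, Rmult_lt_0_compat. }
    repeat (rewrite ?RtoC_mult, ?RtoC_plus, ?RtoC_minus, ?RtoC_div by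
      (assumption || lra)).
    field; cbv beta.
    (* Each denominator other than [d] is folded back into a single real number, so that its
       nonvanishing becomes a real statement. *)
    rewrite <- !RtoC_mult, <- !RtoC_minus, <- !RtoC_plus.
    repeat split; try exact Hd0; apply RtoC_neq_0; lra.
Qed.
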